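(* Let $n\ge 5$ be an integer with $n\equiv 2,3,4,7,8$ or $9\pmod{10}$. Then the necessary conditions are sufficient for the existence of a near-minimal configuration $(1,5)$ $GDD(n,2,6;\lambda_1,\lambda_2)$; that is, for every such $n$ there exists a configuration $(1,5)$ $GDD(n,2,6;\lambda_1,\lambda_2)$ whose indices are exactly twice the minimal indices, namely $(\lambda_1,\lambda_2)=(10n,5(n-1))$ if $n\equiv 3,7,9\pmod{10}$ and $(\lambda_1,\lambda_2)=(20n,10(n-1))$ if $n\equiv 2,4,8\pmod{10}$.
   Context: A $GDD(n,2,6;\lambda_1,\lambda_2)$ is a finite collection (repetitions allowed) of $6$-element subsets, called blocks, of a $2n$-element set $X$ partitioned into two groups of size $n$, such that every point lies in the same number $r$ of blocks, any two distinct points of the same group lie together in exactly $\lambda_1$ blocks, and any two points from different groups lie together in exactly $\lambda_2$ blocks. It has configuration $(1,5)$ if every block has exactly $1$ point in one of the two groups and $5$ points in the other (which group contains the single point may depend on the block). For the values of $n$ considered here, the minimal indices for configuration $(1,5)$ are the smallest positive integers $\lambda_1,\lambda_2$ satisfying the necessary conditions that $\lambda_2=\frac{\lambda_1(n-1)}{2n}$ and that the number of blocks $\frac{\lambda_1 n(n-1)+\lambda_2n^2}{15}$ and the replication number $r=\frac{\lambda_1(n-1)+\lambda_2 n}{5}$ are integers; these are $\left(5n,\frac{5(n-1)}{2}\right)$ if $n\equiv 3,7,9\pmod{10}$ and $(10n,5(n-1))$ if $n\equiv 2,4,8\pmod{10}$. A configuration $(1,5)$ GDD is near-minimal if its indices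 are exactly twice the minimal indices. *)

(* Defs.v *)
From mathcomp Require Import all_boot.

Set Implicit Arguments.
Unset Strict Implicit.
Unset Printing Implicit Defensive.

Section GDD.

Variable X : finType.

(* P is the set of groups.  The blocks form a list because they may be
   repeated; nothing below depends on their order. *)
Implicit Types (P : {set {set X}}) (B : seq {set X}).

Definition replication B (x : X) : nat := count (fun b : {set X} => x \in b) B.

Definition concurrence B (x y : X) : nat :=
  count (fun b : {set X} => (x \in b) && (y \in b)) B.

Record is_GDD (n m k l1 l2 : nat) P B : Prop := IsGDD {
  gdd_points : #|X| = m * n;
  gdd_partition : partition P [set: X];
  gdd_group_count : #|P| = m;
  gdd_group_size : forall G, G \in P -> #|G| = n;
  gdd_block_size : forall b, b \in B -> #|b| = k;
  gdd_replication : exists r, forall x, replication B x = r;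
  gdd_same_group : forall G x y, G \in P -> x \in G -> y \in G -> x != y ->
    concurrence B x y = l1;
  gdd_distinct_groups : forall G H x y, G \in P -> H \in P -> G != H ->
    x \in G -> y \in H -> concurrence B x y = l2
}.

(* Meant for two groups.  The roles of G and H may vary with the block. *)
Definition has_configuration (s t : nat) P B : Prop :=
  forall b, b \in B -> exists G H,
    [/\ G \in P, H \in P, G != H, #|b :&: G| = s & #|b :&: H| = t].

End GDD.

(* The first equation is l2 = l1 (n - 1) / (2 n) with the denominator cleared;
   the two divisibilities say that the number of blocks and the replication
   number are integers. *)
Definition necessary_conditions (n l1 l2 : nat) : Prop :=
  [/\ 2 * n * l2 = l1 * (n - 1),
      15 %| l1 * n * (n - 1) + l2 * n ^ 2
    & 5 %| l1 * (n - 1) + l2 * n].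

Definition minimal_indices (n l1 l2 : nat) : Prop :=
  [/\ 0 < l1, 0 < l2, necessary_conditions n l1 l2
    & forall m1 m2, 0 < m1 -> 0 < m2 -> necessary_conditions n m1 m2 ->
        l1 <= m1 /\ l2 <= m2].

Definition near_minimal_indices (n l1 l2 : nat) : Prop :=
  exists m1 m2, [/\ minimal_indices n m1 m2, l1 = 2 * m1 & l2 = 2 * m2].

Definition near_minimal_GDD15 (n l1 l2 : nat) (X : finType)
    (P : {set {set X}}) (B : seq {set X}) : Prop :=
  [/\ is_GDD n 2 6 l1 l2 P B, has_configuration 1 5 P B
    & near_minimal_indices n l1 l2].

(* Main.v *)
Require Import Defs.
From mathcomp Require Import all_boot all_algebra zify.

Set Implicit Arguments.
Unset Strict Implicit.
Unset Printing Implicit Defensive.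

(* Given a BIBD(n, 5, lam) with replication number r, joining every block placed
   on one group to every point of the other group, for both choices of the
   group, gives a configuration (1, 5) GDD with indices (n lam, 2 r).  Since
   r = lam (n - 1) / 4, twice the minimal indices are obtained from lam = 10 for
   n odd and from lam = 20 for n even.

   If n is coprime to 6, the translates of {0, x, 2x, 3x, 4x} form a
   BIBD(n, 5, 10) on Z/n.  Otherwise truncate one group of a transversal design
   with six groups of size m, m coprime to 6, to u <= m points: its lines have
   5 or 6 points.  If n = 5m + u is even, m and u can be chosen coprime to 6, and
   it remains to put BIBDs with lam = 20 on lines and groups.  If n is an odd
   multiple of 3, write (n - 1)/2 = 5m + u with 2m + 1 and 2u + 1 coprime to 6,
   replace every point by two copies, put GDDs of type 2^5 and 2^6 on the lines,
   and put BIBDs on the doubled groups completed by a common point at infinity.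
   This works for large n; the small values use explicit difference families
   and transversal designs with up to three truncated groups. *)

(** * Block designs with blocks of size 5 *)

Section Design.

Variable T : eqType.
Implicit Types (V W : pred T) (c : T -> T -> nat) (L : seq (seq T)).

Definition cov L (x y : T) := count (fun b => (x \in b) && (y \in b)) L.

(** Prescribing the concurrence pair by pair covers BIBDs, GDDs and their superpositions by one
    notion. The predicate [V] lets designs on different subsets of one ambient type be added. *)
Definition design V c := exists L,
  (forall b, b \in L -> [/\ uniq b, size b = 5 & {subset b <= V}]) /\
  (forall x y, V x -> V y -> x != y -> cov L x y = c x y).

Lemma cov_cat L1 L2 x y : cov (L1 ++ L2) x y = cov L1 x y + cov L2 x y.
Proof. exact: count_cat. Qed.

Lemma cov_out V L x y : (forall b, b \in L -> {subset b <= V}) ->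
  ~~ (V x && V y) -> cov L x y = 0.
Proof.
move=> sLV nV; apply/eqP; rewrite -leqn0 leqNgt -has_count; apply/hasPn => b bL.
by apply: contra nV => /andP[/(sLV b bL) Vx /(sLV b bL) Vy]; rewrite [V x]Vx.
Qed.

Lemma eq_design V V' c c' : V =1 V' ->
  (forall x y, V x -> V y -> x != y -> c x y = c' x y) ->
  design V c -> design V' c'.
Proof.
move=> eV ec [L [LV Lc]]; exists L; split=> [b /LV[u s sb] | x y].
  by split=> // x /sb; rewrite !unfold_in eV.
by rewrite -!eV => Vx Vy nxy; rewrite Lc ?ec.
Qed.

Lemma design_nil V c : (forall x y, V x -> V y -> x != y -> c x y = 0) -> design V c.
Proof. by move=> c0; exists [::]; split=> // x y *; rewrite c0. Qed.

Lemma sub_design V W c : (forall x, V x -> W x) -> design V c ->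
  design W (fun x y => (V x && V y) * c x y).
Proof.
move=> VW [L [LV Lc]]; exists L; split=> [b /LV[u s sb] | x y _ _ nxy].
  by split=> // x /sb /VW.
have [/andP[Vx Vy]|nV] := boolP (V x && V y); first by rewrite mul1n Lc.
by rewrite (@cov_out V) // => b /LV[].
Qed.

Lemma design_add V c1 c2 : design V c1 -> design V c2 ->
  design V (fun x y => c1 x y + c2 x y).
Proof.
move=> [L1 [LV1 Lc1]] [L2 [LV2 Lc2]]; exists (L1 ++ L2); split=> [b|x y *].
  by rewrite mem_cat => /orP[/LV1|/LV2].
by rewrite cov_cat Lc1 ?Lc2.
Qed.

(** Superposition: the union of the block lists adds concurrences, and the [j]-th design contributes
    nothing to a pair that is not inside [V j]. *)
Lemma design_sum (J : eqType) (js : seq J) W (V : J -> pred T)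
    (c : J -> T -> T -> nat) :
  (forall j x, j \in js -> V j x -> W x) ->
  (forall j, j \in js -> design (V j) (c j)) ->
  design W (fun x y => \sum_(j <- js) (V j x && V j y) * c j x y).
Proof.
elim: js => [|j js IH] VW dj; first by apply: design_nil => *; rewrite big_nil.
have dj0 := sub_design (fun x => VW j x (mem_head _ _)) (dj j (mem_head _ _)).
have djs : design W (fun x y => \sum_(j <- js) (V j x && V j y) * c j x y).
  by apply: IH => [i x ijs|i ijs]; [apply: VW|apply: dj]; rewrite inE ijs orbT.
by apply: eq_design (design_add dj0 djs) => // x y *; rewrite big_cons.
Qed.

End Design.

Lemma design_map (T T' : eqType) (f : T -> T') (V : pred T) (V' : pred T') c c' :
  (forall x y, V x -> V y -> f x = f y -> x = y) ->
  (forall x, V x -> V' (f x)) -> (forall y, V' y -> exists2 x, V x & f x = y) ->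
  (forall x y, V x -> V y -> x != y -> c x y = c' (f x) (f y)) ->
  design V c -> design V' c'.
Proof.
move=> finj fV fV' ec [L [LV Lc]]; exists [seq map f b | b <- L]; split.
  move=> _ /mapP[b /LV[ub sb bV] ->]; rewrite size_map; split=> //.
    by rewrite map_inj_in_uniq // => x y /bV Vx /bV Vy; apply: finj.
  by move=> _ /mapP[x /bV Vx ->]; apply: fV.
move=> _ _ /fV'[x Vx <-] /fV'[y Vy <-] nf.
have nxy : x != y by apply: contraNneq nf => ->.
rewrite -ec // -Lc // /cov count_map; apply: eq_in_count => b /LV[_ _ bV] /=.
have mf z : V z -> (f z \in map f b) = (z \in b).
  move=> Vz; apply/mapP/idP => [[t tb /finj -> //]|zb]; last by exists z.
  exact: bV.
by rewrite !mf.
Qed.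

Definition bibd v lam := design (fun x => x < v) (fun _ _ => lam).

(* The k groups of size w are the residue classes mod k. *)
Definition gdd w k lam :=
  design (fun x => x < w * k) (fun x y => lam * (x %% k != y %% k)).

(** Only the number of points matters, so a design on an initial segment of the naturals can be
    moved to any duplicate-free list. *)
Lemma bibd_design (T : eqType) (s : seq T) lam :
  uniq s -> bibd (size s) lam <-> design (fun x => x \in s) (fun _ _ => lam).
Proof.
move=> us; case: s us => [|x0 s'].
  move=> _; split=> _; exact: design_nil.
move: (x0 :: s') => s us; split; last first.
  apply: (design_map (f := fun x => index x s)) => // [x y xs ys|x|i lti].
  - by move/(congr1 (nth x0 s)); rewrite !nth_index.
  - by rewrite index_mem.
  by exists (nth x0 s i); rewrite ?mem_nth ?index_uniq.
apply: (design_map (f := nth x0 s)) => // [i j li lj|i|x xs].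
- by move/eqP; rewrite nth_uniq // => /eqP.
- exact: mem_nth.
by exists (index x s); rewrite ?index_mem ?nth_index.
Qed.

Lemma bibd_le1 v lam : v <= 1 -> bibd v lam.
Proof. by move=> v1; apply: design_nil => x y; lia. Qed.

Lemma gdd1 k lam : bibd k lam -> gdd 1 k lam.
Proof.
apply: eq_design => [x|x y lx ly nxy] /=; first by rewrite mul1n.
by rewrite !modn_small // nxy muln1.
Qed.

Lemma bibd_mul a v lam : bibd v lam -> bibd v (a * lam).
Proof.
move=> d; elim: a => [|a IH]; first exact: design_nil.
by apply: eq_design (design_add d IH) => // x y; rewrite mulSn.
Qed.

(** * Difference families *)

Section Development.

Variable G : finZmodType.
Implicit Types (B : seq G) (D : seq (seq G)).
Import GRing.Theory.

Definition diffs D := flatten [seq [seq (x - y)%R | x <- B, y <- B] | B <- D].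

Definition translates D : seq (seq G) := [seq [seq (x + a)%R | x <- B] | B <- D, a <- enum G].

Lemma mem_translate B (a p : G) : (p \in [seq (x + a)%R | x <- B]) = ((p - a)%R \in B).
Proof.
apply/mapP/idP => [[x xB ->]|pB]; first by rewrite addrK.
by exists (p - a)%R; rewrite ?subrK.
Qed.

Lemma count_translates (P : pred (seq G)) D :
  count P (translates D) = \sum_(B <- D) \sum_(a : G) P [seq (x + a)%R | x <- B].
Proof.
rewrite /translates count_flatten -map_comp sumnE big_map.
apply: eq_bigr => B _; rewrite /= count_map.
by rewrite -sum1_count big_mkcond /= -big_enum; apply: eq_bigr => a _ /=; case: (P _).
Qed.

(** The translate of [B] by a contains p and q iff p - a and q - a lie in [B]. Hence the translates
    of [B] through both points correspond to the ordered pairs of [B] with difference p - q. *)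
Lemma cov_translates D (p q : G) : all uniq D ->
  cov (translates D) p q = count_mem (p - q)%R (diffs D).
Proof.
move=> uD; rewrite /cov count_translates /diffs count_flatten -map_comp sumnE big_map.
apply: eq_big_seq => B /(allP uD) uB /=.
under eq_bigr => a _ do rewrite !mem_translate.
have -> : count_mem (p - q)%R [seq (x - y)%R | x <- B, y <- B] =
    \sum_(x <- B) ((x - (p - q))%R \in B).
  rewrite count_flatten -map_comp sumnE big_map; apply: eq_bigr => x _ /=.
  rewrite count_map -(count_uniq_mem _ uB); apply: eq_count => y /=.
  by rewrite -(inj_eq (@subrI _ x)) subKr.
rewrite (big_uniq _ uB) [RHS]big_mkcond /=.
rewrite (reindex_inj (h := fun a => p - a)%R) /=; last by move=> a b /subrI.
by apply: eq_bigr => a _; rewrite subKr !opprB; case: (a \in B); rewrite // addrCA addrC.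
Qed.

Lemma mem_translates D b : b \in translates D ->
  exists2 B, B \in D & exists a, b = [seq (x + a)%R | x <- B].
Proof. by case/allpairsPdep=> B [a [BD _ ->]]; exists B => //; exists a. Qed.

(* The point at infinity None is present when e = 1; it is added to the
   translates of the blocks of D1. *)
Lemma design_development (e : bool) lam (gam : G -> nat) (D0 D1 : seq (seq G)) :
  (forall B, B \in D0 -> uniq B /\ size B = 5) ->
  (forall B, B \in D1 -> uniq B /\ size B = 4) ->
  (if e then 4 * size D1 = lam else D1 = [::]) ->
  (forall d, d != 0%R -> count_mem d (diffs (D0 ++ D1)) = gam d) ->
  design (fun p : option G => e || (p : bool)) (fun x y =>
    if x is Some p then if y is Some q then gam (p - q)%R else lam else lam).
Proof.
move=> H0 H1 He Hd.
exists ([seq map Some b | b <- translates D0] ++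
        [seq None :: map Some b | b <- translates D1]); split.
  have uS b : uniq (map (@Some G) b) = uniq b by rewrite map_inj_uniq // => x y [].
  have uT (a : G) B : uniq [seq (x + a)%R | x <- B] = uniq B.
    by rewrite map_inj_uniq //; apply: addIr.
  move=> b; rewrite mem_cat => /orP[] /mapP[b' /mem_translates[B BD [a ->]] ->].
    have [u s] := H0 B BD; rewrite uS uT !size_map.
    by split=> // _ /mapP[x _ ->]; rewrite unfold_in orbT.
  have [u s] := H1 B BD; rewrite /= uS uT !size_map s u.
  split=> [|//|x _]; last by move: He BD; case: (e) => // ->.
  by rewrite andbT; apply/mapP => -[].
have mS b p : (Some p \in map (@Some G) b) = (p \in b) by rewrite mem_map // => x y [].
have mN b : (None \in map (@Some G) b) = false by apply/mapP => -[].
have covS p q : p != q -> cov ([seq map Some b | b <- translates D0] ++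
        [seq None :: map Some b | b <- translates D1]) (Some p) (Some q) = gam (p - q)%R.
  move=> npq; rewrite cov_cat {1 2}/cov !count_map.
  under eq_count => b do rewrite /= !mS.
  under [X in _ + X]eq_count => b do rewrite /= !inE !mS.
  rewrite -!/(cov _ _ _) -cov_cat -Hd ?subr_eq0 // -cov_translates.
    by rewrite /translates map_cat flatten_cat.
  by apply/allP => B; rewrite mem_cat => /orP[/H0|/H1] [].
(* A point lies in as many translates of a block as the block has elements, so infinity meets q
   exactly 4 times for each block of [D1]. *)
have covN q : e -> cov ([seq map Some b | b <- translates D0] ++
        [seq None :: map Some b | b <- translates D1]) None (Some q) = lam.
  move=> te; move: He; rewrite te => <-; rewrite cov_cat {1 2}/cov !count_map.
  rewrite (@eq_count _ _ pred0) => [|b]; last by rewrite /= mN.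
  rewrite count_pred0 add0n (@eq_count _ _ (fun b => q \in b)); last first.
    by move=> b; rewrite /= !inE mS.
  rewrite count_translates (eq_big_seq (fun _ => 4)).
    by rewrite big_const_seq count_predT iter_addn_0.
  move=> B /H1[uB sB]; under eq_bigr => a _ do rewrite mem_translate.
  rewrite (reindex_inj (h := fun a => q - a)%R) /=; last by move=> a b /subrI.
  under eq_bigr => a _ do rewrite subKr.
  rewrite -sB -(card_uniqP uB) -sum1_card [RHS]big_mkcond.
  by apply: eq_bigr => a _; case: (a \in B).
have cC L x y : cov L x y = cov L y x by apply: eq_count => b; rewrite andbC.
case=> [p|] [q|] //; rewrite ?orbF ?orbT //= => ep eq nxy.
- by apply: covS; apply: contraNneq nxy => ->.
- by rewrite cC covN.
by rewrite covN.
Qed.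

End Development.

(** * Difference families over Z/m in computable form *)

Section Cyclic.

Variable m : nat.
Implicit Types (D : seq (seq nat)).

Definition sub_mod x y := if y <= x then x - y else x + m - y.

Definition nat_diffs D := flatten [seq [seq sub_mod x y | x <- B, y <- B] | B <- D].

(** A histogram: entry d counts the occurrences of d, so one pass over the differences yields all
    multiplicities. *)
Definition tally (s : seq nat) := foldr (fun d t => incr_nth t d) [::] s.

Lemma nth_tally s d : nth 0 (tally s) d = count_mem d s.
Proof. by elim: s => [|x s IH]; rewrite ?nth_nil //= nth_incr_nth IH. Qed.

Definition is_block k (B : seq nat) := [&& uniq B, size B == k & all (fun x => x < m) B].

(** Multiples of [k] must not occur as differences, which makes the residue classes mod [k] the
    groups of a GDD. For [k] equal to the modulus no nonzero difference is excluded, and the result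
    is a BIBD. *)
Definition difference_family (e : bool) k lam D0 D1 :=
  [&& all (is_block 5) D0, all (is_block 4) D1,
      (if e then 4 * size D1 == lam else nilp D1)
    & let t := tally (nat_diffs (D0 ++ D1)) in
      all (fun d => nth 0 t d == lam * ~~ (k %| d)) (iota 1 m.-1)].

End Cyclic.

Section CyclicDesign.

Variable m' : nat.
Let m := m'.+1.
Implicit Types (D : seq (seq nat)).
Import GRing.Theory.

Lemma val_sub (x y : 'I_m) : val (x - y)%R = sub_mod m x y.
Proof.
have lx := ltn_ord x; have ly := ltn_ord y; rewrite /sub_mod /= -/m modnDmr.
case: leqP => xy; last by rewrite modn_small; lia.
by rewrite addnBA 1?ltnW // -addnBAC // modnDr modn_small //; lia.
Qed.

Lemma map_val_diffs D : all (all (fun x => x < m)) D ->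
  map val (diffs (map (map inZp) D : seq (seq 'I_m))) = nat_diffs m D.
Proof.
move=> /allP lD; rewrite /diffs map_flatten -!map_comp; congr flatten.
apply/eq_in_map => B /lD/allP lB /=; rewrite map_allpairs allpairs_mapl allpairs_mapr.
by apply/eq_in_allpairs => x y /lB lx /lB ly; rewrite val_sub /= !modn_small.
Qed.

Lemma inZp_block k B : is_block m k B ->
  uniq (map inZp B : seq 'I_m) /\ size (map inZp B : seq 'I_m) = k.
Proof.
case/and3P=> uB /eqP sB /allP lB; rewrite size_map map_inj_in_uniq //.
by move=> x y /lB lx /lB ly /(congr1 val) /=; rewrite !modn_small.
Qed.

Lemma design_difference_family (e : bool) k lam D0 D1 :
  difference_family m e k lam D0 D1 ->
  design (fun p : option 'I_m => e || (p : bool)) (fun x y =>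
    if x is Some p then if y is Some q then lam * ~~ (k %| val (p - q)%R) else lam
    else lam).
Proof.
case/and4P=> /allP b0 /allP b1 be /allP ok.
pose lift := map (map inZp) : seq (seq nat) -> seq (seq 'I_m).
refine (@design_development _ e lam (fun d : 'I_m => lam * ~~ (k %| val d))
  (lift D0) (lift D1) _ _ _ _).
- by move=> _ /mapP[B /b0 /inZp_block bB ->].
- by move=> _ /mapP[B /b1 /inZp_block bB ->].
- by case: (e) be => [/eqP <-|/nilP ->]; rewrite ?size_map.
move=> d nz; rewrite /lift -map_cat.
have lD : all (all (fun x => x < m)) (D0 ++ D1).
  by apply/allP => B; rewrite mem_cat => /orP[/b0|/b1] /and3P[].
transitivity (count_mem (val d)
    (map val (diffs (map (map inZp) (D0 ++ D1) : seq (seq 'I_m))))).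
  by rewrite count_map; apply: eq_count => x /=; rewrite -val_eqE.
rewrite map_val_diffs // -nth_tally; apply/eqP/ok.
rewrite mem_iota; have := ltn_ord d; have : val d != 0 by []. 
rewrite -/(m) /m /=; lia.
Qed.

Lemma bibd_option_ord (e : bool) lam :
  design (fun p : option 'I_m => e || (p : bool)) (fun _ _ => lam) -> bibd (m + e) lam.
Proof.
apply: (design_map (f := fun p => if p is Some x then val x else m)) => //=.
- case=> [x|] [y|] //= _ _; first by move/val_inj->.
    by move=> e1; have := ltn_ord x; rewrite e1 ltnn.
  by move=> e1; have := ltn_ord y; rewrite -e1 ltnn.
- case=> [x|] /=; first by rewrite ltn_addr.
  by rewrite orbF => ->; rewrite addn1.
move=> y ly; case: (ltnP y m) => lym; first by exists (Some (Ordinal lym)); rewrite ?orbT.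
by exists None; case: (e) ly => //=; lia.
Qed.

Lemma bibd_difference_family (e : bool) lam D0 D1 :
  difference_family m e m lam D0 D1 -> bibd (m + e) lam.
Proof.
move/design_difference_family => d; apply: bibd_option_ord; apply: eq_design d => //.
case=> [x|] [y|] // _ _ nxy; have nz : 0 < val (x - y)%R.
  rewrite lt0n; apply: contraNneq nxy => e0.
  by apply/eqP; congr Some; apply/subr0_eq/val_inj.
by rewrite gtnNdvd ?muln1 // ltn_ord.
Qed.

End CyclicDesign.

Lemma gdd_difference_family w k lam D : 0 < w * k ->
  difference_family (w * k) false k lam D [::] -> gdd w k lam.
Proof.
case E: (w * k) => [//|m'] _ /design_difference_family.
apply: (design_map (f := fun p => if p is Some x then val x else 0)) => //=.
- by case=> [x|] [y|] //= _ _ /val_inj ->.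
- by case=> // x _ /=; rewrite E.
- by move=> y; rewrite E => ly; exists (Some (Ordinal ly)).
have kE : k %| m'.+1 by rewrite -E dvdn_mull.
case=> [x|] [y|] // _ _ _.
rewrite -[(x + _) %% m'.+1]/(val (x - y)%R) val_sub /sub_mod; congr (_ * nat_of_bool (~~ _)).
case: leqP => xy.
  by rewrite eqn_mod_dvd.
have ly := ltn_ord y.
(* Here the subtraction wraps around; since [k] divides the modulus, this does not affect
   divisibility by [k]. *)
have -> : x + m'.+1 - y = m'.+1 - (y - x) by lia.
by rewrite dvdn_subr //; last lia; rewrite eq_sym eqn_mod_dvd 1?ltnW.
Qed.

(** * Arithmetic progressions as base blocks, for orders coprime to 6 *)

Section Multiples.

Variable p : nat.
Hypothesis co6 : coprime p.+2 6.
Import GRing.Theory.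
Local Open Scope ring_scope.

Local Notation Z := 'Z_p.+2.

Let step (x : Z) := [seq x *+ i | i <- iota 0 5].

(** The difference is 1, 2, 3 or 4 up to sign, and 2 and 3 are invertible because the order is
    coprime to 6. *)
Lemma coprime6_unit (i j : nat) : (i < 5)%N -> (j < 5)%N -> i != j ->
  i%:R - j%:R \is a @GRing.unit Z.
Proof.
have small (k : nat) : (0 < k < 5)%N -> (k%:R : Z) \is a GRing.unit.
  move=> k5; rewrite unitZpE //.
  suff: (coprime p.+2 2 /\ coprime p.+2 3)%N.
    by case: k k5 => [|[|[|[|[|k]]]]] // _ [c2 c3]; rewrite ?coprimen1 // (coprimeMr _ 2 2) c2.
  by split; apply: coprime_dvdr co6.
move=> i5 j5; case: ltngtP => // ij _.
  by rewrite -opprB unitrN -natrB 1?ltnW //; apply: small; lia.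
by rewrite -natrB 1?ltnW //; apply: small; lia.
Qed.

Lemma multiples_eq (i j : nat) (x d : Z) : (i < 5)%N -> (j < 5)%N -> i != j ->
  (x *+ i - x *+ j == d) = (x == d / (i%:R - j%:R)).
Proof.
move=> i5 j5 ij; have u := coprime6_unit i5 j5 ij.
rewrite -(mulr_natr x i) -(mulr_natr x j) -mulrBr.
by apply/eqP/eqP => [<-|->]; rewrite ?mulrK ?divrK.
Qed.

(** By [multiples_eq], each of the 20 ordered pairs of distinct positions yields a given nonzero d
    for exactly one multiplier x. All multipliers together thus produce d 20 times, and half of them
    produce it 10 times. *)
Lemma design_multiples :
  design (fun p : option Z => false || (p : bool)) (fun x y =>
    if x is Some p then if y is Some q then 10%N else 10%N else 10%N).
Proof.
(* [P] selects from x and -x the one with the smaller representative, and excludes 0. *)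
pose P := [pred x : Z | val x < val (- x)]%N.
pose F (d x : Z) := (\sum_(i < 5) \sum_(j < 5) ((x *+ i - x *+ j)%R == d))%N.
have FN d x : F d (- x) = F d x.
  rewrite /F exchange_big; apply: eq_bigr => i _; apply: eq_bigr => j _.
  by rewrite !mulNrn opprK addrC.
apply: (@design_development _ false 10 (fun=> 10%N) [seq step x | x <- enum P] [::]) => //.
  move=> _ /mapP[x Px ->]; rewrite size_map size_iota map_inj_in_uniq ?iota_uniq //.
  move=> i j; rewrite !mem_iota !add0n /= => i5 j5 e; apply/eqP/negPn/negP => ij.
  have : x *+ i - x *+ j == 0 by rewrite e subrr.
  rewrite multiples_eq // mul0r => /eqP x0.
  by move: Px; rewrite mem_enum x0 inE oppr0 ltnn.
move=> d nd; rewrite cats0.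
have -> : count_mem d (diffs [seq step x | x <- enum P]) = (\sum_(x | P x) F d x)%N.
  rewrite /diffs count_flatten -!map_comp sumnE big_map big_enum_cond /=.
  apply: eq_big => [x|x _ /=]; first by rewrite andbT.
  by rewrite /F !(big_ord_recr, big_ord0) /= !add0n !addn0 !addnA.
have P0 : P 0 = false by rewrite /P inE oppr0 ltnn.
have F0 : F d 0 = 0%N.
  rewrite /F big1 // => i _; rewrite big1 // => j _.
  by rewrite !mul0rn subrr eq_sym (negPf nd).
have PN x : P (- x) = ~~ P x && (x != 0).
  have PE z : P z = (val z < val (- z))%N by [].
  rewrite !PE opprK -leqNgt [in RHS]leq_eqVlt.
  have [->|x0] := eqVneq x 0; first by rewrite oppr0 ltnn andbF.
  (* A nonzero x differs from -x: otherwise 2x = 0, and 2 is a unit. *)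
  rewrite andbT; case: eqP => // /val_inj e; case/negP: x0.
  have := @multiples_eq 2 0 x 0 isT isT isT; rewrite mul0r => <-.
  by rewrite mulr0n subr0 mulr2n -{1}e addNr.
(* x and -x give the same block up to translation, so one multiplier from each
   pair suffices. *)
have dbl : (\sum_(x | P x) F d x + \sum_(x | P x) F d x = \sum_x F d x)%N.
  rewrite [X in (_ + X)%N](reindex_inj oppr_inj).
  under [X in (_ + X)%N]eq_bigr => x _ do rewrite FN.
  rewrite [RHS](bigID P) /=; congr (_ + _)%N.
  rewrite [RHS](bigD1 (0 : Z)); last exact: negbT P0.
  rewrite F0 -[RHS]/(0 + _)%N add0n.
  by apply: eq_bigl => x; apply: PN.
have full : (\sum_x F d x = 20)%N.
  rewrite /F exchange_big /=.
  under eq_bigr => i _ do rewrite exchange_big /=.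
  rewrite (eq_bigr (fun i : 'I_5 => \sum_(j < 5) (i != j)))%N.
    by rewrite !big_ord_recr !big_ord0.
  move=> i _; apply: eq_bigr => j _; have [->|ij] := eqVneq i j.
    by rewrite big1 // => x _; rewrite subrr eq_sym (negPf nd).
  under eq_bigr => x _ do rewrite multiples_eq //.
  by rewrite -big_mkcond /= sum1_card card1.
lia.
Qed.

End Multiples.

Lemma bibd_coprime6 m : coprime m 6 -> bibd m 10.
Proof.
case: m => [|[|p]] co; try exact: bibd_le1.
rewrite -[p.+2]addn0; apply: (@bibd_option_ord p.+1 false).
by apply: eq_design (design_multiples co) => // -[x|] [y|].
Qed.

(** * Truncated transversal designs *)

Section TransversalDesign.

Variables k m : nat.
Hypothesis cokm : coprime m (k - 2)`!.

(* The point of the line l = (a, b) in the i-th group. *)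
Definition td (l : nat * nat) i := if i == k.-1 then l.2 else (l.1 + i * l.2) %% m.

Definition td_lines := [seq (a, b) | a <- iota 0 m, b <- iota 0 m].

Lemma mem_td_lines l : (l \in td_lines) = (l.1 < m) && (l.2 < m).
Proof.
case: l => a b; apply/allpairsP/andP => [[[a' b'] [/= + + [-> ->]]]|[/= la lb]].
  by rewrite !mem_iota.
by exists (a, b); rewrite !mem_iota.
Qed.

Lemma td_ltn l i : l \in td_lines -> td l i < m.
Proof.
rewrite mem_td_lines /td => /andP[l1 l2]; case: eqP => // _.
by rewrite ltn_pmod // (leq_trans _ l1).
Qed.

(** If neither group is the last one, subtracting coordinates gives (j - i)(b - b') = 0 mod [m].
    Since 0 < j - i <= k - 2, the factor j - i divides (k - 2)! and is invertible. The last group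
    shows b directly. *)
Lemma td_inj i j : i < j -> j < k ->
  {in td_lines &, injective (fun l => (td l i, td l j))}.
Proof.
move=> ij jk [a b] [a' b']; rewrite !mem_td_lines /= => /andP[am bm] /andP[am' bm'].
have /negPf ik : i != k.-1 by lia.
rewrite /td /= ik => -[ei ej].
suff eb : b = b'.
  rewrite -eb in ei *; congr (_, _); move/eqP: ei.
  by rewrite eqn_modDr !modn_small // => /eqP.
move: ej; case: eqP => // /eqP jk1 ej.
have split_j c : j * c = i * c + (j - i) * c by rewrite -mulnDl subnKC // ltnW.
move: ej; rewrite !split_j !addnA -modnDml ei modnDml => /eqP; rewrite eqn_modDl.
wlog le_b : b b' bm bm' {ei am am' split_j} / b' <= b.
  move=> W e; case: (leqP b' b) => [le|/ltnW le]; first exact: W.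
  by apply/esym/W; rewrite // eq_sym.
rewrite eqn_mod_dvd ?leq_mul2l ?le_b ?orbT // -mulnBr Gauss_dvdr; last first.
  by apply: coprime_dvdr cokm; apply: dvdn_fact; lia.
by move=> /dvdn_leq; lia.
Qed.

(** Lines and coordinate pairs both range over the same m^2 pairs, so the injection of [td_inj] is a
    bijection: two points of different groups lie on exactly one line. *)
Lemma td_count i j x y : i != j -> i < k -> j < k -> x < m -> y < m ->
  count (fun l => (td l i == x) && (td l j == y)) td_lines = 1.
Proof.
move=> nij ik jk; wlog ij : i j nij ik jk x y / i < j.
  move=> W xm ym; have [ij|ji|ij] := ltngtP i j; first exact: W.
    have nji : j != i by rewrite neq_ltn ji.
    by rewrite -(W j i nji jk ik y x ji ym xm); apply: eq_count => l; rewrite andbC.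
  by rewrite ij eqxx in nij.
move=> xm ym; pose F l := (td l i, td l j).
have uL : uniq td_lines.
  by apply: allpairs_uniq; rewrite ?iota_uniq // => -[a b] [a' b'] _ _ [-> ->].
have uF : uniq (map F td_lines) by rewrite map_inj_in_uniq //; apply: td_inj.
have sF : {subset map F td_lines <= td_lines}.
  by move=> _ /mapP[l lL ->]; rewrite mem_td_lines !td_ltn.
have [|_ eF] := uniq_min_size uF sF; first by rewrite size_map.
have : count_mem (x, y) (map F td_lines) = 1.
  by rewrite count_uniq_mem // eF mem_td_lines /= xm ym.
by rewrite count_map => <-; apply: eq_count.
Qed.

End TransversalDesign.

Lemma sum_nat_pred1 (T : eqType) (s : seq T) (P : pred T) lam :
  \sum_(x <- s) P x * lam = count P s * lam.
Proof.
by rewrite -big_distrl /= -sum1_count [in RHS]big_mkcond.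
Qed.

(** * Wilson's construction: weighting the points, filling lines and groups *)

Section Wilson.

Variables (w k m lam : nat) (e : bool) (g : nat -> nat).
Hypothesis cokm : coprime m (k - 2)`!.
Hypothesis le_g : forall i, i < k -> g i <= m.

(** The groups in which the line still has a point after truncation. *)
Let S (l : nat * nat) := [seq i <- iota 0 k | td k m l i < g i].

Hypothesis gdd_line : forall l, l \in td_lines m -> gdd w (size (S l)) lam.
Hypothesis bibd_group : forall i, i < k -> bibd (w * g i + e) lam.

(* Some (i, x, s) is the s-th copy of the point x of the i-th group; None is a
   point at infinity, present when e = 1. *)
Let point := option (nat * nat * nat).

Let grp (p : point) := if p is Some (i, _, _) then i else k.

Let total (p : point) :=
  if p is Some (i, x, s) then [&& i < k, x < g i & s < w] else e.

Let on_line l (p : point) :=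
  if p is Some (i, x, s) then [&& i < k, x == td k m l i, x < g i & s < w] else false.

Let in_group j (p : point) :=
  if p is Some (i, x, s) then [&& i == j, x < g i & s < w] else e.

(** The point z of the ingredient GDD becomes copy z / n of the point of the line in its (z mod
    n)-th surviving group. The residue classes mod n thus turn into the sets of [w] copies of one
    point. *)
Lemma design_line l : l \in td_lines m ->
  design (on_line l) (fun p q => lam * (grp p != grp q)).
Proof.
move=> lL; set n := size (S l).
have uS : uniq (S l) by rewrite filter_uniq ?iota_uniq.
have memS i : (i \in S l) = (td k m l i < g i) && (i < k) by rewrite mem_filter mem_iota.
have modS z : z < w * n -> z %% n < n.
  by have [->|n0] := posnP n; [rewrite muln0 | rewrite ltn_pmod].
pose f z : point := let i := nth 0 (S l) (z %% n) in Some (i, td k m l i, z %/ n).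
have eq_nth z1 z2 : z1 < w * n -> z2 < w * n ->
    (nth 0 (S l) (z1 %% n) == nth 0 (S l) (z2 %% n)) = (z1 %% n == z2 %% n).
  by move=> l1 l2; rewrite nth_uniq ?modS.
apply: (design_map (f := f)) (gdd_line lL) => [z1 z2 l1 l2|z lz|p|z1 z2 l1 l2 _].
- move=> [/eqP + _ ed]; rewrite eq_nth // => /eqP em.
  by rewrite (divn_eq z1 n) (divn_eq z2 n) ed em.
- have := mem_nth 0 (modS z lz); rewrite memS /f /= => /andP[-> ->]; rewrite eqxx /=.
  have n0 : 0 < n by rewrite lt0n; apply: contraTneq lz; rewrite -/n => ->; rewrite muln0.
  by rewrite ltn_divLR.
- case: p => [[[i x] s]|] //= /and4P[ik /eqP -> lx ls].
  have iS : i \in S l by rewrite memS lx.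
  have := iS; rewrite -index_mem -/n => lt_i.
  have n0 : 0 < n by apply: leq_ltn_trans lt_i.
  exists (s * n + index i (S l)).
    by rewrite (leq_trans (n := s * n + n)) ?ltn_add2l // -mulSnr leq_mul2r ls orbT.
  by rewrite /f modnMDl modn_small // nth_index // divnMDl // divn_small ?addn0.
by rewrite /f /= eq_nth.
Qed.

Lemma design_group i : i < k -> design (in_group i) (fun _ _ => lam).
Proof.
move=> ik; pose pts : seq point :=
  nseq e None ++ [seq Some (i, x, s) | x <- iota 0 (g i), s <- iota 0 w].
have upts : uniq pts.
  rewrite cat_uniq allpairs_uniq ?iota_uniq //; last by move=> [x s] [x' s'] _ _ [-> ->].
  rewrite andbT; apply/andP; split; first by case: (e).
  by apply/hasPn => _ /allpairsP[? [_ _ ->]]; case: (e).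
have szp : size pts = w * g i + e by rewrite size_cat size_nseq size_allpairs !size_iota; lia.
have := bibd_group ik; rewrite -szp => /(bibd_design _ upts).
apply: eq_design => // -[[[j x] s]|]; rewrite mem_cat; last first.
  rewrite mem_nseq eqxx andbT lt0b (_ : _ \in _ = false) ?orbF //.
  by apply/negbTE/negP => /allpairsP[? [_ _]].
have -> : Some (j, x, s) \in nseq e None = false by rewrite mem_nseq andbF.
apply/allpairsP/and3P => [[[x' s'] /= [+ + [-> -> ->]]]|[/eqP -> xg sw]].
  by rewrite !mem_iota.
by exists (x, s); rewrite !mem_iota.
Qed.

(** Two points over different groups get [lam] from the unique line through them and nothing from
    the groups. Two points over the same group, or a point and infinity, get nothing from the lines
    and [lam] from one group. *)
Lemma design_total : design total (fun _ _ => lam).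
Proof.
have dl : design total (fun p q => \sum_(l <- td_lines m)
    (on_line l p && on_line l q) * (lam * (grp p != grp q))).
  by apply: design_sum design_line => l [[[i x] s]|] //= _ /and4P[-> _ -> ->].
have dg : design total (fun p q => \sum_(j <- iota 0 k) (in_group j p && in_group j q) * lam).
  apply: design_sum => [j [[[i x] s]|]|j] //=; rewrite mem_iota => jk;
    last exact: design_group.
  by move=> /and3P[/eqP -> -> ->]; rewrite !andbT; case/andP: jk.
have cnt1 i : i < k -> count (fun j => i == j) (iota 0 k) = 1.
  move=> ik; rewrite (eq_count (a2 := pred1 i)) => [|j]; last exact: eq_sym.
  by rewrite count_uniq_mem ?iota_uniq // mem_iota ik.
apply: eq_design (design_add dl dg) => // p q; rewrite !sum_nat_pred1.
case: p q => [[[i x] s]|] [[[j y] t]|] //=; last 2 first.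
- move=> /and3P[ik xg sw] ee _; 
  rewrite (eq_count (a2 := pred0)) ?count_pred0 ?mul0n; last first.
    by move=> l /=; rewrite andbF.
  rewrite (eq_count (a2 := fun j => i == j)) ?cnt1 ?mul1n // => l.
  by rewrite /= xg sw ee !andbT.
- move=> ee /and3P[jk yg tw] _; rewrite count_pred0 mul0n.
  rewrite (eq_count (a2 := fun l => j == l)) ?cnt1 ?mul1n // => l.
  by rewrite /= yg tw ee !andbT.
move=> /and3P[ik xg sw] /and3P[jk yg tw] npq.
have [eij|nij] := eqVneq i j.
  rewrite !muln0 (eq_count (a2 := fun l => i == l)) ?cnt1 ?mul1n // => l.
  by rewrite /= xg sw yg tw -eij !andbT andbb.
rewrite muln1 (eq_count (a2 := fun l => (td k m l i == x) && (td k m l j == y))); last first.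
  move=> l; rewrite /= ik jk xg sw yg tw !andbT [x == _]eq_sym [y == _]eq_sym //.
rewrite td_count ?(leq_trans xg) ?(leq_trans yg) ?le_g // mul1n.
rewrite (eq_count (a2 := pred0)) ?count_pred0 ?mul0n ?addn0 // => l /=.
by rewrite sw tw !andbT; apply/negbTE; apply: contraNN nij => /andP[/eqP -> /eqP ->].
Qed.

Lemma bibd_wilson : bibd (w * sumn (map g (iota 0 k)) + e) lam.
Proof.
pose pts : seq point := nseq e None ++
  [seq Some (p, s) | p <- [seq (i, x) | i <- iota 0 k, x <- iota 0 (g i)], s <- iota 0 w].
have upts : uniq pts.
  rewrite cat_uniq; apply/and3P; split; first by case: (e).
    by apply/hasPn => _ /allpairsP[? [_ _ ->]]; rewrite mem_nseq andbF.
  rewrite allpairs_uniq ?iota_uniq //; last by move=> [p s] [p' s'] _ _ [-> ->].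
  rewrite allpairs_uniq_dep ?iota_uniq // => [i _|[i x] [i' x'] _ _ [-> ->] //].
  exact: iota_uniq.
have szp : size pts = w * sumn (map g (iota 0 k)) + e.
  rewrite size_cat size_nseq size_allpairs size_allpairs_dep size_iota addnC mulnC.
  by congr (_ * sumn _ + _); apply: eq_map => i; rewrite size_iota.
rewrite -szp; apply/(bibd_design _ upts); apply: eq_design design_total => // p.
rewrite mem_cat mem_nseq lt0b; case: p => [[[i x] s]|]; last first.
  rewrite eqxx andbT (_ : _ \in _ = false) ?orbF //.
  by apply/negbTE/negP => /allpairsP[? [_ _]].
rewrite andbF orFb; apply/idP/idP.
  move=> /and3P[ik xg sw]; apply/allpairsP; exists (i, x, s); rewrite !mem_iota /=.
  by split=> //; apply/allpairsPdep; exists i, x; rewrite !mem_iota.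
move=> /allpairsP[[p s'] /= [/allpairsPdep[i' [x' [+ + ->]]] + [-> -> ->]]].
by rewrite !mem_iota => /= -> -> ->.
Qed.

End Wilson.

(** * Explicit difference families *)

(* A family (m, h, t, F, D) stands for the base blocks over Z/m consisting of F
   and of the multiples of the blocks of D by 1, h, ..., h^(t-1).  Blocks of
   size 4 are completed by the point at infinity.  The families below were found
   by computer search. *)
Definition cyclic_family : Type := nat * nat * nat * seq (seq nat) * seq (seq nat).

Definition modulus (r : cyclic_family) := let: (m, _, _, _, _) := r in m.

Definition base_blocks (r : cyclic_family) := let: (m, h, t, F, D) := r in
  F ++ flatten [seq traject (map (fun x => (x * h) %% m)) B t | B <- D].

Definition bibd_family (e : bool) lam (r : cyclic_family) :=
  (0 < modulus r) && difference_family (modulus r) e (modulus r) lam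
    [seq B <- base_blocks r | size B == 5] [seq B <- base_blocks r | size B == 4].

Definition gdd_family w k lam (r : cyclic_family) :=
  (0 < w * k) && difference_family (w * k) false k lam (base_blocks r) [::].

Definition odd_families : seq cyclic_family := [::
  (9, 1, 1,
   [::],
   [:: [:: 0; 1; 2; 3; 7]; [:: 0; 1; 2; 4; 7]; [:: 0; 1; 2; 4; 7]; [:: 0; 1; 2; 5; 6]]);
  (15, 1, 1,
   [::],
   [:: [:: 0; 1; 2; 5; 8]; [:: 0; 1; 2; 10; 11]; [:: 0; 1; 3; 6; 8];
       [:: 0; 1; 3; 11; 12]; [:: 0; 1; 4; 9; 13]; [:: 0; 1; 6; 11; 13];
       [:: 0; 2; 4; 8; 11]]);
  (27, 1, 1,
   [::],
   [:: [:: 0; 1; 2; 20; 25]; [:: 0; 1; 4; 5; 16]; [:: 0; 1; 6; 10; 14];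
       [:: 0; 1; 7; 10; 22]; [:: 0; 1; 9; 16; 17]; [:: 0; 1; 11; 17; 25];
       [:: 0; 1; 16; 22; 25]; [:: 0; 2; 5; 12; 19]; [:: 0; 2; 5; 19; 23];
       [:: 0; 2; 6; 16; 20]; [:: 0; 2; 7; 16; 20]; [:: 0; 2; 8; 10; 22];
       [:: 0; 3; 6; 15; 22]]);
  (33, 4, 5,
   [:: [:: 1; 4; 16; 25; 31]],
   [:: [:: 0; 1; 2; 12; 28]; [:: 0; 1; 3; 13; 15]; [:: 0; 1; 3; 14; 20]]);
  (39, 16, 3,
   [:: [:: 0; 1; 13; 16; 22]],
   [:: [:: 0; 1; 4; 32; 33]; [:: 0; 1; 5; 19; 24]; [:: 0; 1; 7; 11; 19];
       [:: 0; 1; 10; 13; 16]; [:: 0; 1; 18; 27; 29]; [:: 0; 2; 4; 6; 32]]);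
  (63, 37, 3,
   [:: [:: 0; 7; 9; 18; 36]; [:: 0; 9; 14; 18; 36]; [:: 0; 9; 18; 21; 36];
       [:: 0; 9; 18; 28; 36]],
   [:: [:: 0; 1; 2; 3; 8]; [:: 0; 1; 5; 21; 49]; [:: 0; 1; 13; 17; 57];
       [:: 0; 1; 15; 17; 39]; [:: 0; 1; 23; 52; 54]; [:: 0; 1; 39; 42; 50];
       [:: 0; 2; 8; 42; 58]; [:: 0; 3; 8; 28; 31]; [:: 0; 3; 13; 33; 57]])].

(** The moduli are odd and infinity makes the order even. Every family expands to five blocks of
    size 4, since infinity must meet each point 4 * 5 = 20 times. *)
Definition even_families : seq cyclic_family := [::
  (5, 1, 1,
   [::],
   [:: [:: 0; 1; 2; 3; 4]; [:: 0; 1; 2; 3]; [:: 0; 1; 2; 3]; [:: 0; 1; 2; 3];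
       [:: 0; 1; 2; 3]; [:: 0; 1; 2; 3]]);
  (7, 1, 1,
   [::],
   [:: [:: 0; 1; 2; 3; 4]; [:: 0; 1; 2; 3; 5]; [:: 0; 1; 2; 4; 5]; [:: 0; 1; 2; 3];
       [:: 0; 1; 2; 4]; [:: 0; 1; 2; 4]; [:: 0; 1; 3; 4]; [:: 0; 1; 3; 5]]);
  (11, 3, 5,
   [:: [:: 1; 3; 4; 5; 9]; [:: 2; 6; 7; 8; 10]],
   [:: [:: 0; 1; 2; 3; 7]; [:: 0; 1; 3; 4]]);
  (13, 3, 3,
   [:: [:: 0; 1; 3; 9]; [:: 0; 2; 5; 6]],
   [:: [:: 0; 1; 2; 3; 11]; [:: 0; 1; 2; 7; 10]; [:: 0; 1; 3; 7; 9]; [:: 0; 1; 2; 9]]);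
  (17, 1, 1,
   [::],
   [:: [:: 0; 1; 2; 6; 9]; [:: 0; 1; 2; 6; 15]; [:: 0; 1; 2; 7; 9];
       [:: 0; 1; 3; 4; 13]; [:: 0; 1; 3; 5; 10]; [:: 0; 1; 3; 5; 14];
       [:: 0; 1; 3; 7; 10]; [:: 0; 1; 3; 9; 15]; [:: 0; 1; 4; 6; 12];
       [:: 0; 1; 4; 6; 13]; [:: 0; 1; 6; 9; 14]; [:: 0; 1; 7; 11; 14];
       [:: 0; 2; 4; 9; 12]; [:: 0; 1; 6; 7]; [:: 0; 1; 7; 12]; [:: 0; 1; 11; 14];
       [:: 0; 2; 4; 12]; [:: 0; 2; 9; 13]]);
  (21, 4, 3,
   [:: [:: 0; 1; 4; 7; 16]; [:: 0; 1; 4; 16]; [:: 0; 2; 7; 8; 11]; [:: 0; 2; 8; 11]],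
   [:: [:: 0; 1; 2; 3; 9]; [:: 0; 1; 2; 4; 18]; [:: 0; 1; 2; 7; 9];
       [:: 0; 1; 3; 11; 15]; [:: 0; 1; 8; 10; 19]; [:: 0; 1; 4; 6]]);
  (23, 1, 1,
   [::],
   [:: [:: 0; 1; 2; 3; 21]; [:: 0; 1; 3; 8; 19]; [:: 0; 1; 4; 10; 16];
       [:: 0; 1; 5; 7; 17]; [:: 0; 1; 5; 9; 13]; [:: 0; 1; 5; 12; 18];
       [:: 0; 1; 5; 13; 17]; [:: 0; 1; 7; 9; 18]; [:: 0; 1; 8; 9; 18];
       [:: 0; 1; 10; 14; 21]; [:: 0; 1; 12; 15; 21]; [:: 0; 1; 13; 18; 21];
       [:: 0; 2; 4; 8; 17]; [:: 0; 2; 4; 11; 20]; [:: 0; 2; 6; 15; 20];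
       [:: 0; 2; 8; 10; 16]; [:: 0; 3; 6; 13; 16]; [:: 0; 3; 8; 11; 19];
       [:: 0; 3; 10; 14; 19]; [:: 0; 1; 2; 6]; [:: 0; 1; 3; 10]; [:: 0; 1; 3; 11];
       [:: 0; 1; 13; 19]; [:: 0; 2; 9; 20]]);
  (27, 1, 1,
   [::],
   [:: [:: 0; 1; 2; 13; 18]; [:: 0; 1; 2; 14; 25]; [:: 0; 1; 3; 7; 19];
       [:: 0; 1; 3; 8; 22]; [:: 0; 1; 3; 9; 13]; [:: 0; 1; 3; 10; 11];
       [:: 0; 1; 3; 16; 21]; [:: 0; 1; 4; 11; 14]; [:: 0; 1; 4; 20; 23];
       [:: 0; 1; 5; 12; 24]; [:: 0; 1; 6; 11; 20]; [:: 0; 1; 6; 16; 20];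
       [:: 0; 1; 7; 11; 18]; [:: 0; 1; 8; 21; 23]; [:: 0; 1; 13; 16; 23];
       [:: 0; 1; 15; 20; 22]; [:: 0; 2; 4; 16; 21]; [:: 0; 2; 6; 17; 24];
       [:: 0; 2; 7; 21; 24]; [:: 0; 2; 8; 13; 17]; [:: 0; 2; 11; 16; 20];
       [:: 0; 3; 6; 12; 16]; [:: 0; 3; 8; 18; 21]; [:: 0; 1; 15; 19]; [:: 0; 2; 4; 21];
       [:: 0; 2; 6; 21]; [:: 0; 2; 10; 20]; [:: 0; 3; 12; 21]]);
  (31, 5, 3,
   [:: [:: 0; 1; 5; 25]; [:: 0; 2; 10; 19]],
   [:: [:: 0; 1; 2; 4; 11]; [:: 0; 1; 2; 18; 28]; [:: 0; 1; 3; 5; 28];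
       [:: 0; 1; 3; 10; 12]; [:: 0; 1; 4; 18; 22]; [:: 0; 1; 5; 21; 28];
       [:: 0; 1; 6; 9; 22]; [:: 0; 1; 9; 12; 13]; [:: 0; 1; 10; 18; 28];
       [:: 0; 1; 12; 23]]);
  (33, 4, 5,
   [:: [:: 1; 4; 16; 25; 31]; [:: 2; 8; 17; 29; 32]; [:: 3; 9; 12; 15; 27];
       [:: 6; 18; 21; 24; 30]],
   [:: [:: 0; 1; 2; 8; 9]; [:: 0; 1; 5; 8; 14]; [:: 0; 1; 5; 10; 29];
       [:: 0; 1; 5; 14; 16]; [:: 0; 1; 6; 11; 28]; [:: 0; 1; 5; 23]]);
  (37, 10, 3,
   [:: [:: 0; 1; 10; 26]; [:: 0; 2; 15; 20]],
   [:: [:: 0; 1; 3; 6; 11]; [:: 0; 1; 3; 14; 33]; [:: 0; 1; 4; 7; 23];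
       [:: 0; 1; 4; 15; 28]; [:: 0; 1; 5; 14; 22]; [:: 0; 1; 6; 14; 16];
       [:: 0; 1; 6; 22; 28]; [:: 0; 1; 9; 17; 26]; [:: 0; 1; 9; 25; 34];
       [:: 0; 1; 13; 32; 35]; [:: 0; 2; 4; 24; 33]; [:: 0; 1; 32; 35]]);
  (43, 6, 3,
   [:: [:: 0; 1; 6; 36]; [:: 0; 2; 12; 29]],
   [:: [:: 0; 1; 2; 17; 24]; [:: 0; 1; 4; 10; 17]; [:: 0; 1; 4; 15; 34];
       [:: 0; 1; 4; 18; 40]; [:: 0; 1; 5; 15; 23]; [:: 0; 1; 6; 21; 32];
       [:: 0; 1; 6; 23; 41]; [:: 0; 1; 9; 13; 29]; [:: 0; 1; 11; 13; 40];
       [:: 0; 1; 11; 15; 26]; [:: 0; 1; 14; 23; 31]; [:: 0; 1; 20; 29; 32];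
       [:: 0; 2; 10; 35; 40]; [:: 0; 2; 20; 35]])].

(** GDDs of type 2^k for k = 5, 6, 7, 8, the possible sizes of lines when up to three groups are
    truncated. *)
Definition gdd2_families : seq cyclic_family := [::
  (10, 1, 1,
   [::],
   [:: [:: 0; 1; 2; 3; 4]; [:: 0; 1; 2; 4; 8]; [:: 0; 1; 2; 4; 8]; [:: 0; 1; 3; 4; 7]]);
  (12, 1, 1,
   [::],
   [:: [:: 0; 1; 2; 4; 5]; [:: 0; 1; 2; 9; 10]; [:: 0; 1; 3; 4; 8]; [:: 0; 1; 3; 5; 8];
       [:: 0; 1; 3; 8; 10]]);
  (14, 1, 1,
   [::],
   [:: [:: 0; 1; 2; 5; 11]; [:: 0; 1; 2; 6; 12]; [:: 0; 1; 2; 10; 12];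
       [:: 0; 1; 3; 6; 12]; [:: 0; 1; 4; 10; 12]; [:: 0; 1; 5; 6; 11]]);
  (16, 1, 1,
   [::],
   [:: [:: 0; 1; 2; 3; 12]; [:: 0; 1; 2; 4; 11]; [:: 0; 1; 3; 12; 13];
       [:: 0; 1; 4; 7; 13]; [:: 0; 1; 5; 11; 14]; [:: 0; 1; 6; 11; 13];
       [:: 0; 2; 4; 6; 11]])].

Definition gdd4_family : cyclic_family :=
  (68, 37, 16,
   [::],
   [:: [:: 0; 1; 4; 31; 53]; [:: 0; 1; 6; 38; 54]]).

Lemma bibd_families e lam families v : all (bibd_family e lam) families ->
  v \in [seq modulus r + e | r <- families] -> bibd v lam.
Proof.
move=> /allP ok /mapP[r /ok/andP[]]; case: (modulus r) => // m _ rD ->.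
exact: bibd_difference_family rD.
Qed.

Lemma bibd_odd_family v : v \in [:: 9; 15; 27; 33; 39; 63] -> bibd v 10.
Proof. by apply: (@bibd_families false _ odd_families); vm_compute. Qed.

Lemma bibd_even_family v : v \in [:: 6; 8; 12; 14; 18; 22; 24; 28; 32; 34; 38; 44] ->
  bibd v 20.
Proof. by apply: (@bibd_families true _ even_families); vm_compute. Qed.

Lemma gdd_families w lam families k :
  all (fun r => gdd_family w (modulus r %/ w) lam r) families ->
  k \in [seq modulus r %/ w | r <- families] -> gdd w k lam.
Proof. by move=> /allP ok /mapP[r /ok/andP[wk rD] ->]; apply: gdd_difference_family rD. Qed.

Lemma gdd2 k : 5 <= k <= 8 -> gdd 2 k 10.
Proof.
move=> k58; apply: (@gdd_families _ _ gdd2_families); first by vm_compute.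
have: k \in iota 5 4 by rewrite mem_iota.
by vm_compute.
Qed.

Lemma gdd4_17 : gdd 4 17 10.
Proof. by apply: (@gdd_families _ _ [:: gdd4_family]); vm_compute. Qed.

(** * Existence of BIBDs *)

Section Truncation.

Variables (w lam : nat) (e : bool) (known : pred nat).
Hypothesis known_bibd : forall v, known v -> bibd v lam.

(* Five full groups of size m, and one group of each size u in us. *)
Definition truncation_ok m us :=
  [&& coprime m (3 + size us)`!, all (fun u => u <= m) us &
      all (fun u => known (w * u + e)) (m :: us)].

(** Every line keeps its points in the five full groups, so its size lies between 5 and 5 +
    [size us]; Wilson's construction then applies with k = 5 + [size us]. *)
Lemma bibd_truncation m us :
  (forall s, 5 <= s <= 5 + size us -> gdd w s lam) ->
  truncation_ok m us -> bibd (w * (5 * m + sumn us) + e) lam.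
Proof.
move=> gdd_s /and3P[co /allP le_us /allP kn].
pose g i := nth 0 ([:: m; m; m; m; m] ++ us) i.
have gP i : i < 5 + size us -> g i \in m :: us.
  move=> lt_i; have : g i \in [:: m; m; m; m; m] ++ us by apply: mem_nth.
  by rewrite !inE; case: (g i == m).
have gE : map g (iota 0 (5 + size us)) = [:: m; m; m; m; m] ++ us.
  by rewrite -[LHS]/(mkseq g (size ([:: m; m; m; m; m] ++ us))) mkseq_nth.
have -> : 5 * m + sumn us = sumn (map g (iota 0 (5 + size us))) by rewrite gE /=; lia.
apply: (@bibd_wilson w (5 + size us) m lam e g).
- by rewrite (_ : 5 + size us - 2 = 3 + size us) //; lia.
- by move=> i /gP; rewrite inE => /orP[/eqP -> //|/le_us].
- move=> l lL; apply: gdd_s; rewrite size_filter iotaD count_cat.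
  set P := fun i => _; have := count_size P (iota (0 + 5) (size us)).
  suff -> : count P (iota 0 5) = 5 by rewrite size_iota; lia.
  apply/eqP; rewrite -[5]/(size (iota 0 5)) -all_count; apply/allP => i.
  rewrite !inE => i5; rewrite /P (_ : g i = m) ?td_ltn //.
  by case/or4P: i5 => [/eqP ->|/eqP ->|/eqP ->|/orP[] /eqP ->].
by move=> i /gP /kn /known_bibd.
Qed.

End Truncation.

Definition known10 v := coprime v 6 || (v \in [:: 9; 15; 27; 33; 39; 63; 69]).

Lemma known10_bibd v : known10 v -> bibd v 10.
Proof.
case/orP; first exact: bibd_coprime6.
rewrite (mem_cat v [:: 9; 15; 27; 33; 39; 63] [:: 69]) => /orP[/bibd_odd_family //|].
rewrite inE => /eqP ->.
(* 69 = 4 * 17 + 1: fill the groups of a GDD of type 4^17 and a point at infinity. *)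
apply: (@bibd_wilson 4 17 1 10 true (fun=> 1)) => [|//|l lL|i _].
- by rewrite coprime1n.
- rewrite size_filter (eq_in_count (a2 := predT)) ?count_predT ?size_iota; last first.
    by move=> i _; rewrite td_ltn.
  exact: gdd4_17.
exact: bibd_coprime6.
Qed.

Definition known20 v := known10 v ||
  (v \in [:: 6; 8; 12; 14; 18; 22; 24; 28; 32; 34; 38; 44]).

Lemma known20_bibd v : known20 v -> bibd v 20.
Proof. by case/orP; [move/known10_bibd/(bibd_mul 2) | apply: bibd_even_family]. Qed.

Definition good10 := truncation_ok 2 true known10.

Definition good20 := truncation_ok 1 false known20.

Lemma bibd_good10 m us : size us <= 3 -> good10 m us ->
  bibd (5 * m + sumn us).*2.+1 10.
Proof.
move=> us3 gd; rewrite -addn1 -mul2n.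
apply: (bibd_truncation (e := true) known10_bibd _ gd) => s s58.
by apply: gdd2; lia.
Qed.

(** With weight 1 the lines need BIBDs of order 5 to 8: orders 5 and 7 are coprime to 6, while 6 and
    8 come from explicit families. *)
Lemma bibd_good20 m us : size us <= 3 -> good20 m us -> bibd (5 * m + sumn us) 20.
Proof.
move=> us3 gd; rewrite -[X in bibd X]addn0 -[X in bibd (X + _)]mul1n.
apply: (bibd_truncation (e := false) known20_bibd _ gd) => s s58; apply/gdd1/known20_bibd.
by have : s \in iota 5 4; [rewrite mem_iota; lia | rewrite !inE => /or4P[] /eqP ->].
Qed.

(** A search with a single truncated group; the range contains every m >= 5 with 5 m <= N. *)
Definition split_good (good : nat -> seq nat -> bool) N :=
  has (fun m => (5 * m <= N) && good m [:: N - 5 * m]) (iota 5 (N %/ 5)).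

Lemma split_goodP good N : split_good good N ->
  exists m u, good m [:: u] /\ N = 5 * m + sumn [:: u].
Proof.
case/hasP => m _ /andP[le_m gm]; exists m, (N - 5 * m); split=> //.
by rewrite /= addn0 subnKC.
Qed.

(** Two truncated groups, for N = 43, 46, 49, 79, 139, that is, for the orders 2 N + 1 = 87, 93, 99,
    159, 279. *)
Definition plans10 := [:: (7, [:: 4; 4]); (7, [:: 6; 5]); (7, [:: 7; 7]);
  (13, [:: 8; 6]); (23, [:: 12; 12])].

(** Two or three truncated groups, for the orders 48, 52, 54, 58, 68, 82, 84, 88, 118. *)
Definition plans20 := [:: (7, [:: 7; 6]); (7, [:: 6; 6; 5]); (7, [:: 7; 6; 6]);
  (11, [:: 1; 1; 1]); (11, [:: 7; 6]); (13, [:: 9; 8]); (13, [:: 11; 8]);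
  (13, [:: 12; 11]); (19, [:: 12; 11])].

Definition value (p : nat * seq nat) := 5 * p.1 + sumn p.2.

Lemma bibd10_small n : odd n -> 5 <= n < 300 -> n %% 5 \in [:: 2; 3; 4] -> bibd n 10.
Proof.
move=> on n5 nmod.
have ok : all (fun p => (size p.2 <= 3) && good10 p.1 p.2) plans10 by vm_compute.
have : all (fun n => odd n && (n %% 5 \in [:: 2; 3; 4]) ==>
  [|| known10 n, split_good good10 n./2 | n./2 \in map value plans10]) (iota 5 295).
  by vm_compute.
move/allP/(_ n); rewrite mem_iota on nmod => /(_ n5) /or3P[|/split_goodP[m [u [mu E]]]|].
- exact: known10_bibd.
- by rewrite -(odd_double_half n) on E; apply: bibd_good10.
case/mapP => p /(allP ok) /andP[sp gp] E.
by rewrite -(odd_double_half n) on E; apply: bibd_good10.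
Qed.

Lemma bibd20_small n : ~~ odd n -> 5 <= n < 300 -> n %% 5 \in [:: 2; 3; 4] -> bibd n 20.
Proof.
move=> on n5 nmod.
have ok : all (fun p => (size p.2 <= 3) && good20 p.1 p.2) plans20 by vm_compute.
have : all (fun n => ~~ odd n && (n %% 5 \in [:: 2; 3; 4]) ==>
  [|| known20 n, split_good good20 n | n \in map value plans20]) (iota 5 295).
  by vm_compute.
move/allP/(_ n); rewrite mem_iota on nmod => /(_ n5) /or3P[|/split_goodP[m [u [mu ->]]]|].
- exact: known20_bibd.
- exact: bibd_good20.
by case/mapP => p /(allP ok) /andP[sp gp] ->; apply: bibd_good20.
Qed.

Lemma coprime6E v : coprime v 6 = odd v && (v %% 3 != 0).
Proof. by rewrite (coprimeMr v 2 3) coprimen2 coprime_sym prime_coprime. Qed.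

Lemma coprime24 v : coprime v 6 -> coprime v 4`!.
Proof. by rewrite (coprimeMr v 2 3) (coprimeMr v (2 ^ 3) 3) coprime_pexpr. Qed.

Lemma bibd10 n : odd n -> 5 <= n -> n %% 5 \in [:: 2; 3; 4] -> bibd n 10.
Proof.
(* The bound 300 gives (n - 1)/2 >= 150, so that s >= 4 below and m >= 29 >= u. *)
move=> on n5 nmod; have [n300|n300] := ltnP n 300; first by apply: bibd10_small; rewrite // n5.
have [c6|] := boolP (coprime n 6); first exact: bibd_coprime6.
rewrite coprime6E on /= negbK => /eqP n3.
(* m = 6 s + 5 and u = 0 %[mod 3] make 2 m + 1 and 2 u + 1 coprime to 6. *)
set s := (n./2 - 25) %/ 30; set u := (n./2 - 25) %% 30.
have E : n./2 = 5 * (6 * s + 5) + sumn [:: u].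
  by rewrite /= /s /u; have := divn_eq (n./2 - 25) 30; have := odd_double_half n; lia.
rewrite -(odd_double_half n) on E; apply: bibd_good10 => //.
have n2 := odd_double_half n; rewrite on in n2.
have lu : u < 30 by rewrite ltn_pmod.
rewrite /good10 /truncation_ok coprime24 /known10 /= ?coprime6E /= in E *; lia.
Qed.

Lemma bibd20 n : ~~ odd n -> 5 <= n -> n %% 5 \in [:: 2; 3; 4] -> bibd n 20.
Proof.
move=> on n5 nmod; have [n300|n300] := ltnP n 300; first by apply: bibd20_small; rewrite // n5.
(* m = 6 s + c with c chosen such that u = n - 5 m is coprime to 3. *)
pose c := if n %% 6 == 4 then 1 else 5.
set s := (n - 5 * c) %/ 30; set u := (n - 5 * c) %% 30.
have E : n = 5 * (6 * s + c) + sumn [:: u].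
  by rewrite /= /s /u; have := divn_eq (n - 5 * c) 30; rewrite /c; case: ifP => _; lia.
have lu : u < 30 by rewrite ltn_pmod.
rewrite E; apply: bibd_good20 => //; move: E; rewrite /= /c.
rewrite /good20 /truncation_ok coprime24 /known20 /known10 /= ?coprime6E /=; case: ifP; lia.
Qed.

(** * From BIBDs to group divisible designs *)

Lemma sum_count_exchange (S T : Type) (P : S -> pred T) (s : seq S) (t : seq T) :
  \sum_(x <- s) count (P x) t = \sum_(y <- t) count (P ^~ y) s.
Proof.
elim: s => [|x s IH]; first by rewrite big_nil big1.
rewrite big_cons IH -sum1_count big_mkcond -big_split /=.
by apply: eq_bigr => y _; case: (P x y).
Qed.

Section BibdToGDD.

Variables (n lam r : nat) (L : seq (seq nat)).
Hypothesis L_block : forall b, b \in L -> [/\ uniq b, size b = 5 & {subset b <= gtn n}].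
Hypothesis L_cov : forall x y, x < n -> y < n -> x != y -> cov L x y = lam.
Hypothesis r_def : lam * n.-1 = 4 * r.

(** Counting the pairs (y, b) with x and y in b in two ways gives 5 R = R + lam (n - 1), the summand
    R coming from y = x. *)
Lemma count_mem_block x : x < n -> count (fun b => x \in b) L = r.
Proof.
move=> xn; set R := count _ L.
have : \sum_(y <- iota 0 n) cov L x y = 5 * R.
  transitivity (\sum_(b <- L) (x \in b) * 5); last first.
    by rewrite sum_nat_pred1 mulnC.
  rewrite sum_count_exchange; apply: eq_big_seq => b /L_block[ub sb bn].
  case: (x \in b); last by rewrite count_pred0.
  rewrite mul1n -sb -size_filter; apply: perm_size.
  apply: uniq_perm; rewrite ?filter_uniq ?iota_uniq // => z.
  by rewrite mem_filter mem_iota; apply/andb_idr => /bn.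
rewrite (bigD1_seq x) ?iota_uniq ?mem_iota //=.
have -> : cov L x x = R by apply: eq_count => b; rewrite andbb.
rewrite big_seq_cond (eq_bigr (fun=> lam)) => [|y]; last first.
  by rewrite mem_iota eq_sym => /andP[yn yx]; apply: L_cov.
rewrite -big_seq_cond big_const_seq iter_addn_0.
have := count_predC (pred1 x) (iota 0 n).
rewrite count_uniq_mem ?iota_uniq // mem_iota xn size_iota.
rewrite (@eq_count _ (predC _) (fun y => y != x)) //; nia.
Qed.

Let X : finType := (bool * 'I_n)%type.

Let group (h : bool) : {set X} := [set p | p.1 == h].

Let blk (h : bool) (y : 'I_n) (b : seq nat) : {set X} :=
  [set p | if p.1 == h then val p.2 \in b else p.2 == y].

Let groups : {set {set X}} := [set group true; group false].

Let blocks := [seq blk p.1 p.2 b | p <- enum {: bool * 'I_n}, b <- L].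

Lemma card_ord_mem b : uniq b -> {subset b <= gtn n} ->
  #|[set x : 'I_n | val x \in b]| = size b.
Proof.
move=> ub bn; rewrite cardE -(size_map val); apply: perm_size; apply: uniq_perm => //.
  by rewrite map_inj_uniq ?enum_uniq //; apply: val_inj.
move=> x; apply/mapP/idP => [[y + ->]|xb]; first by rewrite mem_enum inE.
by have xn := bn x xb; exists (Ordinal xn); rewrite // mem_enum inE.
Qed.

Lemma pair_inj h : injective (fun x : 'I_n => (h, x) : X).
Proof. by move=> x y []. Qed.

Lemma card_blk_big h y b : b \in L -> #|blk h y b :&: group h| = 5.
Proof.
move=> /L_block[ub sb bn]; rewrite -sb -card_ord_mem //.
rewrite -(card_imset _ (@pair_inj h)); apply: eq_card => -[h' x].
rewrite !inE /=; apply/andP/imsetP => [[+ /eqP eh]|[z + [-> ->]]].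
  by rewrite eh eqxx => xb; exists x; rewrite ?inE.
by rewrite inE eqxx.
Qed.

Lemma card_blk_small h y b : #|blk h y b :&: group (~~ h)| = 1.
Proof.
rewrite (_ : _ :&: _ = [set (~~ h, y)]) ?cards1 //; apply/setP => -[h' x].
by rewrite !inE xpair_eqE /= andbC; case: eqP => // ->; case: h.
Qed.

Lemma card_blk h y b : b \in L -> #|blk h y b| = 6.
Proof.
move=> bL; rewrite -(cardsID (group h)) card_blk_big //.
rewrite (_ : _ :\: _ = blk h y b :&: group (~~ h)) ?card_blk_small //.
by apply/setP => -[h' x]; rewrite !inE andbC; case: h'; case: h.
Qed.

Lemma count_blocks (Q : pred {set X}) : count Q blocks =
  \sum_(h : bool) \sum_(y : 'I_n) count (fun b => Q (blk h y b)) L.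
Proof.
rewrite count_flatten -map_comp sumnE big_map big_enum /= pair_big /=.
by apply: eq_bigr => p _; rewrite count_map.
Qed.

Lemma mem_blk h y b h' x : ((h', x) \in blk h y b) = if h' == h then val x \in b else x == y.
Proof. by rewrite inE. Qed.

Lemma sum_bool (F : bool -> nat) h : \sum_(g : bool) F g = F h + F (~~ h).
Proof. by rewrite big_bool; case: h; rewrite // addnC. Qed.

Lemma sum_eq_ord (x : 'I_n) c : \sum_(y : 'I_n) (x == y) * c = c.
Proof.
by rewrite (bigD1 x) //= eqxx mul1n big1 ?addn0 // => y /negPf; rewrite eq_sym => ->.
Qed.

Lemma count_cond (b : bool) (P : pred (seq nat)) : count (fun s => b && P s) L = b * count P L.
Proof. by case: b; rewrite ?mul1n // count_pred0. Qed.

(** A pair inside a group lies in [lam] base blocks, each joined to the [n] points of the other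
    group. For a mixed pair, [r] base blocks through either point are joined to the other point,
    which gives 2 r. *)
Lemma GDD_bibd : 0 < n -> is_GDD n 2 6 (n * lam) (2 * r) groups blocks /\
  has_configuration 1 5 groups blocks.
Proof.
move=> n0; pose x0 : 'I_n := Ordinal n0.
have gP h : group h \in groups by rewrite !inE; case: h; rewrite eqxx ?orbT.
have gI h h' : (group h == group h') = (h == h').
  apply/eqP/eqP => [/setP/(_ (h, x0))|-> //]; by rewrite !inE eqxx => /esym/eqP.
have gE G : G \in groups -> exists h, G = group h.
  by rewrite !inE => /orP[] /eqP ->; [exists true|exists false].
have mem_blocks B : B \in blocks -> exists h y b, b \in L /\ B = blk h y b.
  by case/allpairsPdep => -[h y] [b [_ bL ->]]; exists h, y, b.
split; last first.
  move=> B /mem_blocks[h [y [b [bL ->]]]]; exists (group (~~ h)), (group h).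
  by rewrite !gP gI card_blk_small card_blk_big //; split=> //; case: h.
split.
- by rewrite card_prod card_bool card_ord.
- apply/and3P; split.
  + apply/eqP/setP => -[h x]; rewrite inE; apply/bigcupP; exists (group h) => //.
    by rewrite inE.
  + apply/trivIsetP => A C /gE[h ->] /gE[h' ->]; rewrite gI => nh.
    rewrite -setI_eq0; apply/eqP/setP => -[g x]; rewrite !inE; apply/negbTE.
    by apply: contraNN nh => /andP[/eqP <-].
  + by apply/negP => /gE[h] /setP /(_ (h, x0)); rewrite !inE eqxx.
- by rewrite cards2 gI.
- move=> G /gE[h ->]; rewrite -[RHS](card_ord n) -(card_imset _ (@pair_inj h)).
  apply: eq_card => -[g x]; rewrite inE /=; apply/eqP/imsetP => [->|[z _ [-> _]] //].
  by exists x.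
- by move=> B /mem_blocks[h [y [b [bL ->]]]]; apply: card_blk.
(* A point lies in [r] base blocks on its own group, each used [n] times, and is the single point
   joined to every base block on the other group. *)
- exists (n * r + size L) => -[h x].
  rewrite /replication count_blocks (sum_bool _ h); congr (_ + _).
    under eq_bigr => y _ do under eq_count => b do rewrite mem_blk eqxx.
    by rewrite sum_nat_const card_ord count_mem_block ?ltn_ord.
  rewrite -[RHS](sum_eq_ord x); apply: eq_bigr => y _.
  rewrite -count_predT -count_cond; apply: eq_count => b.
  by rewrite mem_blk andbT; case: (h).
- move=> G p q /gE[h ->]; case: p q => [g x] [g' y]; rewrite !inE /= => /eqP -> /eqP -> nxy.
  have {}nxy : x != y by apply: contraNneq nxy => ->.
  rewrite /concurrence count_blocks (sum_bool _ h) [X in _ + X]big1 ?addn0; last first.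
    move=> z _; rewrite (eq_count (a2 := pred0)) ?count_pred0 // => b.
    rewrite !mem_blk (_ : h == ~~ h = false) /=; last by case: (h).
    by apply/negbTE; apply: contraNN nxy => /andP[/eqP -> /eqP ->].
  under eq_bigr => z _ do under eq_count => b do rewrite !mem_blk eqxx.
  rewrite (eq_bigr (fun => lam)) => [|z _]; first by rewrite sum_nat_const card_ord.
  by apply: L_cov; rewrite ?ltn_ord //.
move=> G H p q /gE[h ->] /gE[h' ->]; rewrite gI => nh.
case: p q => [g x] [g' y]; rewrite !inE /= => /eqP -> /eqP ->.
have -> : h' = ~~ h by case: (h) (h') nh => -[].
rewrite /concurrence count_blocks (sum_bool _ h) mul2n -addnn; congr (_ + _).
  rewrite -[RHS](sum_eq_ord y); apply: eq_bigr => z _.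
  rewrite -(count_mem_block (ltn_ord x)) -count_cond.
  apply: eq_count => b; rewrite !mem_blk eqxx (_ : ~~ h == h = false) 1?andbC //; by case: (h).
rewrite -[RHS](sum_eq_ord x); apply: eq_bigr => z _.
rewrite -(count_mem_block (ltn_ord y)) -count_cond.
by apply: eq_count => b; rewrite !mem_blk eqxx (_ : h == ~~ h = false) //; case: (h).
Qed.

End BibdToGDD.

(* With a / b = 2n / (n - 1) in lowest terms, the admissible indices are the
   multiples (t a, t b) with 5 | t. *)
Lemma minimal_indices_multiple n a b : 1 < n -> n %% 5 \in [:: 2; 3; 4] ->
  coprime a b -> 2 * n * b = a * (n - 1) -> minimal_indices n (5 * a) (5 * b).
Proof.
move=> n1 nmod cab eab.
have a0 : 0 < a.
  rewrite lt0n; apply: contraTneq cab => a0; have -> : b = 0 by nia.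
  by rewrite a0.
have b0 : 0 < b by nia.
(* Since 2 n b = a (n - 1), the first summand is 2 t b n^2, so integrality of the number of blocks
   means that 5 divides t b n^2. *)
have blocks t : (t * a) * n * (n - 1) + (t * b) * n ^ 2 = 3 * (t * b * n ^ 2).
  rewrite (_ : t * a * n * (n - 1) = t * n * (a * (n - 1))); last lia.
  by rewrite -eab -mulnn; lia.
split; rewrite ?muln_gt0 //.
  split; first by nia.
    by rewrite blocks (@dvdn_mul 3 5) // -mulnA dvdn_mulr.
  by rewrite dvdn_add // -mulnA dvdn_mulr.
move=> m1 m2 m10 m20 [em d15 _].
have emb : m2 * a = m1 * b by apply/eqP; rewrite -(eqn_pmul2r (m := n - 1)); nia.
have : a %| m1 by rewrite -(Gauss_dvdl _ cab) -emb dvdn_mull.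
case/dvdnP=> t E1; have E2 : m2 = t * b.
  by apply/eqP; rewrite -(eqn_pmul2r a0) emb E1 mulnAC.
have : 5 %| t * b * n ^ 2.
  by rewrite -(dvdn_pmul2l (p := 3)) // -blocks -E1 -E2.
(* By the residue of n mod 5, neither n nor n - 1 is divisible by 5; as b divides n - 1, the factor
   5 must come from t. *)
have c5 v : v %% 5 != 0 -> coprime 5 v by rewrite prime_coprime // /dvdn.
have cn : coprime 5 n by apply: c5; rewrite !inE in nmod; lia.
have cb : coprime 5 b.
  have cba : coprime b a by rewrite coprime_sym.
  apply: (@coprime_dvdr _ (n - 1)); first by rewrite -(Gauss_dvdr _ cba) -eab dvdn_mull.
  by apply: c5; rewrite !inE in nmod; lia.
rewrite Gauss_dvdl ?coprimeXr // Gauss_dvdl // => /dvdn_leq t5.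
have {}t5 : 5 <= t by apply: t5; rewrite lt0n; apply: contraTneq m10 => t0; rewrite E1 t0.
by rewrite E1 E2 !leq_mul2r t5 !orbT.
Qed.

Lemma near_minimal_GDD15_exists n lam a b : 5 <= n -> n %% 5 \in [:: 2; 3; 4] ->
  bibd n lam -> coprime a b -> 2 * n * b = a * (n - 1) -> n * lam = 10 * a ->
  exists (X : finType) (P : {set {set X}}) (B : seq {set X}),
    near_minimal_GDD15 n (10 * a) (10 * b) P B.
Proof.
move=> n5 nmod [L [L_block L_cov]] cab eab elam.
(* Multiplying by n: n lam (n - 1) = 10 a (n - 1) = 20 n b. So r = 5 b, and the indices (n lam, 2 r)
   are (10 a, 10 b). *)
have r_def : lam * n.-1 = 4 * (5 * b) by nia.
have n0 : 0 < n by lia.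
have [G C] := GDD_bibd L_block L_cov r_def n0.
rewrite -elam (_ : 10 * b = 2 * (5 * b)); last lia.
eexists; eexists; eexists; split; [exact: G | exact: C |].
exists (5 * a), (5 * b); split; [apply: minimal_indices_multiple => //; lia|lia|lia].
Qed.

Theorem mainTheorem12 (n : nat) (hn : 5 <= n)
    (hmod : n %% 10 \in [:: 2; 3; 4; 7; 8; 9]) :
  exists l1 l2 : nat,
    [/\ n %% 10 \in [:: 3; 7; 9] -> l1 = 10 * n /\ l2 = 5 * (n - 1),
        n %% 10 \in [:: 2; 4; 8] -> l1 = 20 * n /\ l2 = 10 * (n - 1)
      & exists (X : finType) (P : {set {set X}}) (B : seq {set X}),
          near_minimal_GDD15 n l1 l2 P B].
Proof.
have nmod : n %% 5 \in [:: 2; 3; 4] by move: hmod; rewrite !inE; lia.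
have [on|en] := boolP (odd n).
  have n2 := odd_double_half n; rewrite on in n2.
  (* For n odd, 2n / (n - 1) has lowest terms a = n and b = (n - 1)/2, and lam = 10. *)
  exists (10 * n), (10 * n./2); split; [lia | rewrite !inE; lia |].
  apply: near_minimal_GDD15_exists (bibd10 on hn nmod) _ _ _; [by []|by []| |lia|lia].
  move: n2; move: n./2 => h <-.
  by rewrite coprime_sym /coprime addnC -muln2 mulnC gcdnMDl gcdn1.
(* For n even, n - 1 is odd and coprime to n, so a = 2n and b = n - 1 are already in lowest terms,
   and lam = 20. *)
exists (20 * n), (10 * (n - 1)); split; [rewrite !inE; lia | lia |].
have -> : 20 * n = 10 * (2 * n) by lia.
apply: near_minimal_GDD15_exists (bibd20 en hn nmod) _ _ _; [by []|by []| |lia|lia].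
case: n hn en {nmod hmod} => // n _; rewrite /= negbK subn1 => on.
by rewrite coprimeMl coprime2n coprimeSn andbT.
Qed.
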